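(* According to Huygens' proposition (that the figure combining a circular segment $ABC$ with its associated triangle $KOH$ has its barycenter at the center $O$ of the circle), the distance from the center of the circle of radius $r$ to the barycenter of the segment with central angle $\theta$ is given by $$\frac{4}{3}\cdot\frac{r\,\sin^3\frac{\theta}{2}}{\theta - \sin\theta}\,.$$
   Context: A circular segment $ABC$ with central angle $\theta$ is the plane region enclosed by an arc of a circle (center $O$, radius $r$) subtending the angle $\theta$ at $O$ and the chord $AC$ joining the endpoints of the arc; $B$ is the midpoint of the arc and $D$ is the midpoint of $AC$. The barycenter is the centroid of a region with uniform density. The triangle $KOH$ associated to the segment is constructed as follows: let $BP$ be the diameter of the circle through $B$ (so it passes through $D$ and $O$); let $G$ be the point on it between $O$ and $P$ with $OG^2 = BD\cdot PD$; then $KH$ is the line through $G$ parallel to $AC$, with $KH = AC$ and $G$ the midpoint of $KH$. Huygens' proposition (Theorem V of his 1651 work Theoremata) states: the barycenter of the figure that combines the segment $ABC$ of the circle with the triangle $KOH$ lies at the center $O$ of the circle. The assertion is that the displayed formula for the distance from $O$ to the barycenter of the segment follows from this proposition. *)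

(* Defs.v *)
From mathcomp Require Import all_boot all_order all_algebra.
From mathcomp Require Import all_classical all_reals all_analysis.

Set Implicit Arguments.
Unset Strict Implicit.
Unset Printing Implicit Defensive.

Import Order.TTheory GRing.Theory Num.Theory.
Import numFieldNormedType.Exports.

Local Open Scope classical_set_scope.
Local Open Scope ring_scope.

Section Plane.
Context {R : realType}.
Implicit Types (O A B C D G H K P X : R * R) (S : set (R * R)).

(* The library norm on R * R is the sup norm; these are the Euclidean notions. *)
Definition dot A B : R := A.1 * B.1 + A.2 * B.2.
Definition dist A B : R := Num.sqrt (dot (B - A) (B - A)).

Definition midpoint A B : R * R := 2^-1 *: (A + B).

Definition between A X B : Prop :=
  exists2 t : R, 0 <= t <= 1 & X = A + t *: (B - A).

Definition parallel A B C D : Prop :=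
  (B - A).1 * (D - C).2 = (B - A).2 * (D - C).1.

Definition area_measure := (@lebesgue_measure R \x @lebesgue_measure R)%E.

Definition mass (rho : R * R -> R) : R := \int[area_measure]_X rho X.

Definition barycenter (rho : R * R -> R) : R * R :=
  ((\int[area_measure]_X (X.1 * rho X)) / mass rho,
   (\int[area_measure]_X (X.2 * rho X)) / mass rho).

(* A homogeneous plate of unit density occupying S has density \1_S.  Two
   plates put together have the sum of their densities: this is the density of
   the union wherever they do not overlap, and overlaps count twice.  A segment
   with central angle at most pi meets its triangle KOH only at O; for larger
   angles they do overlap, and Huygens' proposition holds with this reading. *)
Definition centroid S : R * R := barycenter \1_S.
Definition combined_barycenter (S T : set (R * R)) : R * R :=
  barycenter (\1_S \+ \1_T).

Definition circle_point O (r t : R) : R * R := O + r *: (cos t, sin t).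

(* [phi] is the direction of OB.  The arc of angle [theta] with midpoint B is
   the set of [circle_point O r t] for t between phi - theta / 2 and
   phi + theta / 2, for any theta in ]0, 2 pi[. *)
Definition arc_points O (r theta : R) A B C : Prop :=
  exists phi : R,
    [/\ A = circle_point O r (phi - theta / 2), B = circle_point O r phi
      & C = circle_point O r (phi + theta / 2)].

(* The part of the disc cut off by the chord AC on the side of B; AC is
   perpendicular to BD, where D is the midpoint of AC. *)
Definition circular_segment O (r : R) A B C : set (R * R) :=
  let D := midpoint A C in
  [set X | dist O X <= r /\ 0 <= dot (B - D) (X - D)].

Definition triangle A B C : set (R * R) :=
  [set X | exists a b c : R, [/\ 0 <= a, 0 <= b, 0 <= c, a + b + c = 1
                               & X = a *: A + b *: B + c *: C]].

Definition huygens_triangle O A B C K H : Prop :=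
  let D := midpoint A C in
  exists P G,
    [/\ midpoint B P = O,
        between O G P /\ dist O G ^+ 2 = dist B D * dist P D,
        parallel K H A C,
        dist K H = dist A C
      & midpoint K H = G].

End Plane.

(* Main.v *)
Require Import Defs.
From mathcomp Require Import all_boot all_order all_algebra.
From mathcomp Require Import all_classical all_reals all_analysis.
From mathcomp Require Import measurable_realfun.
From mathcomp Require Import ring lra.

(* The Lebesgue measure of the plane is invariant under shears (Fubini and the
   invariance of length under translation), hence under rotations, which are
   products of shears, and under translations.  This moves the segment to
   x ^ 2 + y ^ 2 <= r ^ 2, r cos (theta / 2) <= x, whose vertical chords have
   length 2 sqrt (r ^ 2 - x ^ 2).  The substitution x = r cos t then gives its
   area r ^ 2 (theta - sin theta) / 2 and its first moment
   2 / 3 (r sin (theta / 2)) ^ 3 along the axis; the quotient is the distance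
   from O to the barycenter. *)

Set Implicit Arguments.
Unset Strict Implicit.
Unset Printing Implicit Defensive.

Import Order.TTheory GRing.Theory Num.Theory.
Import numFieldNormedType.Exports.

Local Open Scope classical_set_scope.
Local Open Scope ring_scope.

Section CircularSegment.
Context {R : realType}.
Local Notation mu := (@lebesgue_measure R).
Local Notation plane := (measurableTypeR R * measurableTypeR R)%type.

(** * Area-preserving maps of the plane *)

(** A measure on the line is determined by its values on half-open intervals, and the pushforward of
    length under a translation gives each of them its length. *)
Lemma lebesgue_measure_translation (b : R) (A : set (measurableTypeR R)) : measurable A ->
  mu ((fun x => x + b) @^-1` A) = mu A.
Proof.
move=> mA.
have mT : measurable_fun [set: measurableTypeR R]
    (fun x : measurableTypeR R => (x + b : measurableTypeR R)).
  exact: measurable_funD.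
apply/esym/(@lebesgue_measure_unique R (pushforward mu
    (fun x : measurableTypeR R => (x + b : measurableTypeR R)))) =>
  //= _ [[a c]] _ <-.
rewrite /pushforward.
rewrite [X in _ = mu X](_ : _ = `](a - b), (c - b)]%classic).
  rewrite !lebesgue_measure_itv/= !lte_fin -!EFinB ltrD2r.
  by case: ifP => // _; congr (_ %:E); ring.
by apply/seteqP; split => x /=; rewrite !in_itv/= ltrBlDr lerBrDr.
Qed.

Lemma measurable_abscissa : measurable_fun [set: plane] (fst : plane -> R).
Proof. exact: measurable_fst. Qed.

Lemma measurable_ordinate : measurable_fun [set: plane] (snd : plane -> R).
Proof. exact: measurable_snd. Qed.

(** With preimages, the second clause says that the pushforward of area under [T] is area, the form
    that change of variables needs. *)
Definition area_preserving (T : R * R -> R * R) : Prop :=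
  measurable_fun [set: plane] (T : plane -> plane) /\
  forall A : set plane, measurable A -> area_measure (T @^-1` A) = area_measure A.

Lemma area_preserving_comp (T U : R * R -> R * R) :
  area_preserving T -> area_preserving U -> area_preserving (T \o U).
Proof.
move=> [mT pT] [mU pU]; split; first exact: measurableT_comp.
move=> A mA; rewrite comp_preimage pU ?pT//.
by rewrite -[_ @^-1` _]setTI; exact: mT.
Qed.

(** The map translates the vertical section at abscissa [x] by the constant [g x], and the product
    measure integrates the lengths of these sections. *)
Lemma area_preserving_shear2 (g : R -> R) : measurable_fun setT g ->
  area_preserving (fun X => (X.1, X.2 + g X.1)).
Proof.
move=> mg; split.
  exact: measurable_fun_pair measurable_abscissa
    (measurable_funD measurable_ordinate (measurableT_comp mg measurable_abscissa)).
move=> A mA; apply: eq_integral => x _ /=.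
rewrite -[RHS](lebesgue_measure_translation (g x)); last exact: measurable_xsection.
by congr (mu _); apply/seteqP; split => y; rewrite /xsection/= !inE.
Qed.

(** Both orders of iterated integration agree on rectangles, hence everywhere by uniqueness of the
    product measure. Horizontal shears need the order that slices by ordinate. *)
Lemma area_measureE2 (A : set plane) : measurable A ->
  area_measure A = (\int[mu]_y mu (ysection A y))%E.
Proof.
move=> mA; rewrite /area_measure.
rewrite (@product_measure_unique _ _ _ _ _ mu mu (mu \x^ mu)%E)//.
by move=> B C mB mC; exact: product_measure2E.
Qed.

Lemma area_preserving_shear1 (g : R -> R) : measurable_fun setT g ->
  area_preserving (fun X => (X.1 + g X.2, X.2)).
Proof.
move=> mg; have mT : measurable_fun [set: plane]
    ((fun X => (X.1 + g X.2, X.2)) : plane -> plane).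
  exact: measurable_fun_pair (measurable_funD measurable_abscissa
    (measurableT_comp mg measurable_ordinate)) measurable_ordinate.
split => // A mA; rewrite !area_measureE2//; last first.
  by rewrite -[_ @^-1` _]setTI; exact: mT.
apply: eq_integral => y _ /=.
rewrite -[RHS](lebesgue_measure_translation (g y)); last exact: measurable_ysection.
by congr (mu _); apply/seteqP; split => x; rewrite /ysection/= !inE.
Qed.

Lemma area_preserving_reflection : area_preserving (fun X => (X.1, - X.2)).
Proof.
split.
  exact: measurable_fun_pair measurable_abscissa
    (measurable_funN measurable_ordinate).
move=> A mA; apply: eq_integral => x _ /=.
rewrite -[RHS]lebesgue_measureN; last exact: measurable_xsection.
by congr (mu _); apply/seteqP; split => y; rewrite /xsection/= !inE.
Qed.

Lemma area_preserving_rotation (c s : R) : c ^+ 2 + s ^+ 2 = 1 ->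
  area_preserving (fun X => (c * X.1 - s * X.2, s * X.1 + c * X.2)).
Proof.
(* A rotation by phi <> pi is a product of three shears, with t = tan (phi / 2). *)
have main (d e : R) : d ^+ 2 + e ^+ 2 = 1 -> d != -1 ->
    area_preserving (fun X => (d * X.1 - e * X.2, e * X.1 + d * X.2)).
  move=> de1 dN1; set t := e / (1 + d).
  have d1 : 1 + d != 0 by apply: contra dN1 => /eqP ?; apply/eqP; lra.
  have te : t * (1 + d) = e by rewrite /t divfK.
  (* Both sides agree after multiplication by [1 + d], since t e (1 + d) = e^2 = (1 - d) (1 + d). *)
  have dE : d = 1 - t * e.
    apply: (mulIf d1); rewrite mulrBl mul1r mulrAC te; nra.
  rewrite (_ : (fun X => _) =
     (fun X => (X.1 + - t * X.2, X.2)) \o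
     (fun X => (X.1, X.2 + e * X.1)) \o
     (fun X => (X.1 + - t * X.2, X.2))).
    have mM k : measurable_fun [set: R] (fun x => k * x).
      exact: measurable_funM.
    do 2 (apply: area_preserving_comp; last by
      first [exact: area_preserving_shear1|exact: area_preserving_shear2]).
    exact: area_preserving_shear1.
  apply/funext => -[x y] /=; congr pair; last by rewrite dE; ring.
  have eE : e = t + t * d by rewrite -te; ring.
  transitivity ((1 - t * e) * x - (t + t * (1 - t * e)) * y); last by ring.
  by rewrite -dE -eE.
move=> cs1; have [cN1|] := eqVneq c (-1); last exact: main.
have s0 : s = 0.
  by apply/eqP; rewrite -sqrf_eq0; apply/eqP; move: cs1; rewrite cN1; lra.
(* The half turn, for which [1 + d] would vanish, is the square of a quarter turn. *)
have quarter : area_preserving (fun X => (0 * X.1 - 1 * X.2, 1 * X.1 + 0 * X.2)).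
  by apply: main; [ring|rewrite eq_sym oppr_eq0 oner_eq0].
rewrite (_ : (fun X => _) =
  (fun X => (0 * X.1 - 1 * X.2, 1 * X.1 + 0 * X.2)) \o
  (fun X => (0 * X.1 - 1 * X.2, 1 * X.1 + 0 * X.2))).
  exact: area_preserving_comp.
by apply/funext => -[x y] /=; rewrite cN1 s0; congr pair; ring.
Qed.

Lemma area_preserving_translation (O : R * R) : area_preserving (+%R O).
Proof.
rewrite (_ : +%R O = (fun X => (X.1 + O.1, X.2)) \o (fun X => (X.1, X.2 + O.2))).
  apply: area_preserving_comp.
    exact: (area_preserving_shear1 (measurable_cst O.1)).
  exact: (area_preserving_shear2 (measurable_cst O.2)).
by apply/funext => -[x y]; case: O => a b /=; congr pair; rewrite addrC.
Qed.

(** Integrability is asked of [f \o T]: in the main use, this is the integrand pulled back to the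
    standard segment, where boundedness gives it at once. *)
Lemma Rintegral_area_preserving (T : R * R -> R * R) (f : R * R -> R) :
  area_preserving T -> measurable_fun [set: plane] (f : plane -> R) ->
  area_measure.-integrable [set: plane] (EFin \o (f \o T)) ->
  \int[area_measure]_X f X = \int[area_measure]_X f (T X).
Proof.
move=> [mT pT] mf If; congr fine.
transitivity (\int[pushforward area_measure (T : plane -> plane)]_X (f X)%:E)%E.
  by apply: eq_measure_integral => A mA _; exact: esym (pT A mA).
rewrite integral_pushforward//; exact/measurable_EFinP.
Qed.

(** * The substitution x = r cos t *)

(** Under x = r cos t the root becomes r sin t, and -dx/dt contributes a second factor r sin t; the
    new integrand is the derivative of [F]. The map decreases on [0, a], so t = 0 corresponds to x =
    r. *)
Lemma integral_sqrt_subst (r a : R) (g F : R -> R) : 0 < r -> 0 < a < pi ->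
  continuous g ->
  (forall t : R, is_derive t 1 F (g (r * cos t) * (2 * (r * sin t) ^+ 2))) ->
  (\int[mu]_(x in `[(r * cos a)%R, r]) (g x * (2 * Num.sqrt (r ^+ 2 - x ^+ 2)))%:E =
   (F a - F 0)%:E)%E.
Proof.
move=> r0 /andP[a0 api] cg dF.
pose G x := g x * (2 * Num.sqrt (r ^+ 2 - x ^+ 2)).
pose C (t : R) := r * cos t.
have dC (t : R) : is_derive t 1 C (- (r * sin t)).
  by rewrite /C; apply: is_derive_eq; rewrite /GRing.scale/=; ring.
have C' : derive1 C = (fun t => - (r * sin t)).
  by apply/funext => t; rewrite derive1E derive_val.
have crsin : continuous (fun t : R => r * sin t).
  by move=> t; apply: cvgM; [exact: cvg_cst|exact: continuous_sin].
have cC' : continuous (derive1 C : R -> R).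
  by rewrite C' => t; apply: cvgN; exact: crsin.
have cC : continuous C.
  move=> t; apply: cvgM; first exact: cvg_cst.
  exact: continuous_cos.
have cS : continuous (fun x : R => r ^+ 2 - x ^+ 2).
  by move=> x; apply: cvgB; [exact: cvg_cst|exact: exprn_continuous].
have cG : continuous G.
  move=> x; apply: cvgM; first exact: cg.
  apply: cvgM; first exact: cvg_cst.
  exact: (continuous_comp (cS x) (@sqrt_continuous R _)).
have := @integration_by_substitution_decreasing R C G 0 a (ltW a0).
have C0 : C 0 = r by rewrite /C cos0 mulr1.
rewrite C0 -[C a]/(r * cos a) => ->; last first.
- exact: continuous_subspaceT.
- split; first by move=> t _; exact: ex_derive.
  + exact/cvg_at_right_filter/cC.
  + exact/cvg_at_left_filter/cC.
- exact: cvgP (cvg_at_left_filter (cC' _)).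
- exact: cvgP (cvg_at_right_filter (cC' _)).
- by move=> t _; exact: cC'.
- move=> x y; rewrite !in_itv/= => /andP[x0 xa] /andP[y0 ya] yx.
  have xpi := le_trans xa (ltW api); have ypi := le_trans ya (ltW api).
  by rewrite /C ltr_pM2l// ltr_cos// in_itv/= ?x0 ?y0.
rewrite EFinB -(@continuous_FTC2 R
  (fun t => g (r * cos t) * (2 * (r * sin t) ^+ 2)) F 0 a a0)//; first last.
- by move=> t _; rewrite derive1E derive_val.
- have cF (t : R) : {for t, continuous F}.
    by apply/differentiable_continuous/derivable1_diffP; exact: ex_derive.
  split; first by move=> t _; exact: ex_derive.
  + exact/cvg_at_right_filter/cF.
  + exact/cvg_at_left_filter/cF.
- apply: continuous_subspaceT => t; apply: cvgM.
    exact: (continuous_comp (cC t) (cg _)).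
  apply: cvgM; first exact: cvg_cst.
  exact: (continuous_comp (crsin t) (@exprn_continuous _ 2 _)).
apply: eq_integral => t; rewrite inE/= in_itv/= => /andP[t0 ta].
(* The square root of (r sin t)^2 is r sin t itself because the sine is nonnegative on [0, pi]. *)
have st0 : 0 <= r * sin t.
  by rewrite mulr_ge0 ?(ltW r0)// sin_ge0_pi// t0 (le_trans ta (ltW api)).
rewrite /= C' opprK; congr (_ %:E).
rewrite -[LHS]/(g (r * cos t) * (2 * Num.sqrt (r ^+ 2 - (r * cos t) ^+ 2)) * (r * sin t)).
rewrite (_ : r ^+ 2 - _ = (r * sin t) ^+ 2).
  by rewrite sqrtr_sqr ger0_norm//; ring.
by rewrite !exprMn sin2cos2; ring.
Qed.

(** * Integrals over a segment in standard position *)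

(** The center is the origin and the axis is the first coordinate axis. The signed number [c] is the
    abscissa of the chord, negative for segments larger than a half disc. *)
Definition standard_segment (r c : R) : set (R * R) :=
  [set X | X.1 ^+ 2 + X.2 ^+ 2 <= r ^+ 2 /\ c <= X.1].

Lemma measurable_standard_segment (r c : R) :
  measurable (standard_segment r c : set plane).
Proof.
have mf : measurable_fun [set: plane]
    ((fun X => X.1 ^+ 2 + X.2 ^+ 2) : plane -> R).
  exact: measurable_funD (measurable_funX 2 measurable_abscissa)
    (measurable_funX 2 measurable_ordinate).
rewrite (_ : standard_segment r c =
  ([set: plane] `&` (fun X => X.1 ^+ 2 + X.2 ^+ 2) @^-1` `]-oo, r ^+ 2])
  `&` ([set: plane] `&` (fst : plane -> R) @^-1` `[c, +oo[)).
  apply: measurableI; first exact: mf.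
  exact: measurable_abscissa.
by apply/seteqP; split => X /=; rewrite !in_itv/= andbT; [move=> []|move=> [[_ ?] []]].
Qed.

Lemma standard_segment_bound (r c : R) X : 0 < r -> standard_segment r c X ->
  `|X.1| <= r /\ `|X.2| <= r.
Proof.
move=> r0 [Xr _]; have r0' := ltW r0.
have H x : x ^+ 2 <= r ^+ 2 -> `|x| <= r.
  by move=> ?; rewrite -sqrtr_sqr -(ger0_norm r0') -sqrtr_sqr ler_wsqrtr.
by split; apply: H; nra.
Qed.

(** A bounded measurable function on a set of finite area is integrable; the segment lies in the
    square [-r, r]^2. The bound is asked only on the segment, so that the coordinate functions
    qualify. *)
Lemma integrable_standard_segment (r c : R) (f : R * R -> R) (M : R) : 0 < r ->
  measurable_fun [set: plane] (f : plane -> R) ->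
  (forall X, standard_segment r c X -> `|f X| <= M) ->
  area_measure.-integrable [set: plane]
    (fun X : plane => (f X * \1_(standard_segment r c) X)%:E).
Proof.
move=> r0 mf fM; have mS := measurable_standard_segment r c.
rewrite (_ : (fun X => _) = (EFin \o f) \_ (standard_segment r c)); last first.
  apply/funext => X; rewrite /patch indicE.
  by case: ifPn => _; rewrite ?mulr1 ?mulr0.
apply/(integrable_mkcond _ mS); apply: measurable_bounded_integrable => //.
- have mI : measurable (`[- r, r]%classic : set (measurableTypeR R)) by [].
  apply: (@le_lt_trans _ _ (area_measure (`[- r, r] `*` `[- r, r]))).
    apply: le_measure; rewrite ?inE//; first exact: measurableX.
    move=> X /(standard_segment_bound r0)[]; rewrite !ler_norml.
    by move=> ? ?; split; rewrite /= in_itv.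
  have -> : area_measure (`[- r, r] `*` `[- r, r]) =
      (mu `[(- r)%R, r] * mu `[(- r)%R, r])%E.
    exact: product_measure1E.
  by rewrite lebesgue_measure_itv/=; case: ifP => _; rewrite -?EFinB -?EFinM ?mule0 ltry.
- exact: measurable_funTS.
- exists M; split; first exact: num_real.
  by move=> y My X SX; exact: le_trans (fM _ SX) (ltW My).
Qed.

Lemma integral_standard_segment_abscissa (r c M : R) (g : R -> R) : 0 < r -> - r <= c ->
  measurable_fun [set: R] g -> (forall x, - r <= x <= r -> `|g x| <= M) ->
  (\int[area_measure]_X (g X.1 * \1_(standard_segment r c) X)%:E =
   \int[mu]_(x in `[c, r]) (g x * (2 * Num.sqrt (r ^+ 2 - x ^+ 2)))%:E)%E.
Proof.
move=> r0 rc mg gM.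
have If := @integrable_standard_segment r c (fun X => g X.1) M r0
  (measurableT_comp mg measurable_abscissa) _.
rewrite -(integral12_prod_meas1 (If _))/=; last first.
  move=> X /(standard_segment_bound r0)[+ _].
  by rewrite ler_norml => /gM.
rewrite [RHS]integral_mkcond; apply: eq_integral => x _.
rewrite /fubini_F /patch mem_setE in_itv/=.
case: ifPn => [/andP[cx xr]|]; last first.
  (* For x < c or x > r the vertical line misses the segment. *)
  rewrite negb_and -!ltNge => xcr; apply: integral0_eq => y _.
  rewrite indicE memNset ?mulr0// => -[/= xyr cx].
  by case/orP: xcr => ?; nra.
set s := Num.sqrt _.
have xr2 : 0 <= r ^+ 2 - x ^+ 2 by nra.
(* For c <= x <= r the vertical section is the chord [-s, s]. *)
rewrite (_ : (fun y => _) = (cst (g x)%:E) \_ `[- s, s]); last first.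
  apply/funext => y; rewrite /patch mem_setE in_itv/= indicE.
  rewrite -ler_norml (_ : (_ \in _) = (`|y| <= s)).
    by case: ifP; rewrite ?mulr1 ?mulr0.
  rewrite -sqrtr_sqr ler_sqrt// lerBrDl.
  by apply/idP/idP => [/set_mem[]//|?]; apply/mem_set; split.
rewrite -integral_mkcond; transitivity ((g x)%:E * mu `[(- s)%R, s])%E.
  exact: integral_cst.
rewrite lebesgue_measure_itv/= lte_fin.
(* The length formula for an interval distinguishes the degenerate chord s = 0, where both sides
   vanish. *)
have [s0|] := ltP (- s) s; first by rewrite -EFinB -EFinM opprK mulr2n mulrDl mul1r.
have : 0 <= s by exact: sqrtr_ge0.
by move=> ? ?; rewrite (_ : s = 0) ?mulr0 ?mule0//; lra.
Qed.

(** The segment is symmetric under the reflection in its axis, which changes the sign of the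
    ordinate, so the integral equals its own opposite. *)
Lemma Rintegral_standard_segment_ordinate (r c : R) : 0 < r ->
  \int[area_measure]_X (X.2 * \1_(standard_segment r c) X) = 0.
Proof.
move=> r0; set f := fun X : R * R => X.2 * \1_(standard_segment r c) X.
have If : area_measure.-integrable [set: plane] (EFin \o f).
  exact: (integrable_standard_segment r0 measurable_ordinate
    (fun X SX => (standard_segment_bound r0 SX).2)).
have fN : f \o (fun X => (X.1, - X.2)) = (fun X => - 1 * f X).
  apply/funext => X; rewrite /f/= mulN1r mulNr; congr (- (_ * _)).
  by rewrite !indicE; congr ((nat_of_bool _)%:R);
    apply/idP/idP => /set_mem H; apply/mem_set;
    move: H; rewrite /standard_segment/= sqrrN.
have mf : measurable_fun [set: plane] (f : plane -> R).
  by case/integrableP: If => /measurable_EFinP.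
have := Rintegral_area_preserving area_preserving_reflection mf.
rewrite fN => /(_ (integrableZl measurableT _ If)).
under [X in _ = X -> _]eq_Rintegral
  do rewrite -[f _]/((f \o (fun X => (X.1, - X.2))) _) fN.
by rewrite RintegralZl//; lra.
Qed.

Lemma Rintegral_standard_segment_abscissa (r a M : R) (g F : R -> R) :
  0 < r -> 0 < a < pi -> continuous g ->
  (forall x, - r <= x <= r -> `|g x| <= M) ->
  (forall t : R, is_derive t 1 F (g (r * cos t) * (2 * (r * sin t) ^+ 2))) ->
  \int[area_measure]_X (g X.1 * \1_(standard_segment r (r * cos a)) X) = F a - F 0.
Proof.
move=> r0 a0pi cg gM dF; rewrite /Rintegral.
rewrite (integral_standard_segment_abscissa (M := M))//.
- by rewrite (integral_sqrt_subst r0 a0pi cg dF).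
- by rewrite -mulrN1 ler_pM2l// cos_geN1.
- exact: continuous_measurable_fun.
Qed.

(** * Area and first moment of the standard segment *)

(** Sector of angle 2t minus the (signed) triangle spanned by its two radii. *)
Definition area_primitive (r t : R) := r ^+ 2 * (t - sin t * cos t).

Lemma is_derive_area_primitive (r t : R) :
  is_derive t 1 (area_primitive r) (2 * (r * sin t) ^+ 2).
Proof.
rewrite /area_primitive; apply: is_derive_eq; rewrite /GRing.scale/=.
have := cos2Dsin2 t; set c := cos t; set s := sin t => cs.
(* The 1 coming from the derivative of t is written as cos^2 + sin^2, so that subtracting cos^2 -
   sin^2 leaves 2 sin^2. *)
by rewrite -[X in X - _]cs; ring.
Qed.

Lemma area_standard_segment (r a : R) : 0 < r -> 0 < a < pi ->
  \int[area_measure]_X \1_(standard_segment r (r * cos a)) X =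
  r ^+ 2 * (a - sin a * cos a).
Proof.
move=> r0 a0pi.
under eq_Rintegral do rewrite -[\1__ _]mul1r.
have dF (t : R) :
    is_derive t 1 (area_primitive r) (cst 1 (r * cos t) * (2 * (r * sin t) ^+ 2)).
  by rewrite mul1r; exact: is_derive_area_primitive.
rewrite (Rintegral_standard_segment_abscissa (M := 1) r0 a0pi _ _ dF).
- by rewrite /area_primitive sin0; ring.
- exact: cst_continuous.
- by move=> x _; rewrite normr1.
Qed.

(** By the mean value theorem this is [a] times the derivative 2 (r sin t)^2 at some t in ]0, a[,
    where the sine is positive. *)
Lemma area_standard_segment_gt0 (r a : R) : 0 < r -> 0 < a < pi ->
  0 < r ^+ 2 * (a - sin a * cos a).
Proof.
move=> r0 /andP[a0 api].
have [||t] := @MVT R (area_primitive r) (fun t => 2 * (r * sin t) ^+ 2) 0 a a0.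
- by move=> t _; exact: is_derive_area_primitive.
- apply: continuous_subspaceT => t.
  by apply/differentiable_continuous/derivable1_diffP; exact: ex_derive.
rewrite in_itv/= => /andP[t0 ta].
rewrite {2}/area_primitive sin0 mul0r subrr mulr0 !subr0 => H.
rewrite -[ltRHS]/(area_primitive r a) H mulr_gt0// mulr_gt0// exprn_gt0// mulr_gt0//.
by rewrite sin_gt0_pi// t0 (lt_trans ta).
Qed.

Lemma moment_standard_segment (r a : R) : 0 < r -> 0 < a < pi ->
  \int[area_measure]_X (X.1 * \1_(standard_segment r (r * cos a)) X) =
  2 / 3 * (r * sin a) ^+ 3.
Proof.
move=> r0 a0pi.
have dF (t : R) : is_derive t 1 (fun t => 2 / 3 * (r * sin t) ^+ 3)
    (id (r * cos t) * (2 * (r * sin t) ^+ 2)).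
  by apply: is_derive_eq; rewrite /GRing.scale/=; field.
rewrite [LHS](Rintegral_standard_segment_abscissa (g := id) (M := r) r0 a0pi _ _ dF).
- by rewrite sin0; ring.
- by move=> x; exact: cvg_id.
- by move=> x; rewrite ler_norml.
Qed.

(** * Transport to a segment in arbitrary position *)

(** For c^2 + s^2 = 1 this is the rigid motion that sends the origin to [O] and the first axis to
    the direction (c, s); [unframe] is its inverse. *)
Definition frame (O : R * R) (c s : R) (X : R * R) : R * R :=
  O + (c * X.1 - s * X.2, s * X.1 + c * X.2).

Definition unframe (O : R * R) (c s : R) (X : R * R) : R * R :=
  (c * (X.1 - O.1) + s * (X.2 - O.2), c * (X.2 - O.2) - s * (X.1 - O.1)).

(** The coordinates of [frame O c s X] are affine in [X], so mass and moments of the moved segment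
    are combinations of the area and first moments of the standard one. *)
Lemma centroid_frame_standard_segment (O : R * R) (r a c s : R) :
  0 < r -> 0 < a < pi -> c ^+ 2 + s ^+ 2 = 1 ->
  let m := 2 / 3 * (r * sin a) ^+ 3 / (r ^+ 2 * (a - sin a * cos a)) in
  centroid (unframe O c s @^-1` standard_segment r (r * cos a)) =
  O + m *: (c, s).
Proof.
move=> r0 a0pi cs1 m; set S0 := standard_segment _ _; set S := _ @^-1` S0.
have pT : area_preserving (frame O c s).
  exact: area_preserving_comp (area_preserving_translation O)
    (area_preserving_rotation cs1).
have pU : measurable_fun [set: plane] (unframe O c s : plane -> plane).
  (* [unframe] is the translation by [- O] followed by the rotation through the opposite angle. *)
  have cs1' : c ^+ 2 + (- s) ^+ 2 = 1 by rewrite sqrrN.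
  rewrite (_ : unframe O c s =
    (fun X => (c * X.1 - (- s) * X.2, - s * X.1 + c * X.2)) \o +%R (- O)).
    exact: (area_preserving_comp (area_preserving_rotation cs1')
      (area_preserving_translation (- O))).1.
  by apply/funext => X; rewrite /unframe/=; congr pair; ring.
have UT X : unframe O c s (frame O c s X) = X.
  case: X => x y; rewrite /unframe/frame/=; congr pair.
    by transitivity ((c ^+ 2 + s ^+ 2) * x); [ring|rewrite cs1 mul1r].
  by transitivity ((c ^+ 2 + s ^+ 2) * y); [ring|rewrite cs1 mul1r].
have mS : measurable (S : set plane).
  by rewrite /S -[_ @^-1` _]setTI; apply: pU => //; exact: measurable_standard_segment.
have IST X : \1_S (frame O c s X) = \1_S0 X :> R.
  by rewrite /S !indicE; congr ((nat_of_bool _)%:R);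
    apply/idP/idP => /set_mem H; apply/mem_set; move: H; rewrite /= UT.
have mI : measurable_fun [set: plane] (\1_S : plane -> R).
  exact: measurable_indic.
have I0 : area_measure.-integrable [set: plane]
    (fun X : plane => (\1_S0 X)%:E).
  have := @integrable_standard_segment r (r * cos a) (cst 1) 1 r0
    (measurable_cst _) _.
  under eq_fun do rewrite mul1r.
  by apply => X _; rewrite normr1.
have I1 := integrable_standard_segment r0 measurable_abscissa
    (fun X (SX : S0 X) => (standard_segment_bound r0 SX).1).
have I2 := integrable_standard_segment r0 measurable_ordinate
    (fun X (SX : S0 X) => (standard_segment_bound r0 SX).2).
(* Applied below to the constant 1 for the mass and to both coordinates for the moments. The
   coefficient [v] drops out because the moment of the ordinate is zero. *)
have affine (f : R * R -> R) (p u v : R) :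
    measurable_fun [set: plane] (f : plane -> R) ->
    (forall X, f (frame O c s X) = p + u * X.1 + v * X.2) ->
    \int[area_measure]_X (f X * \1_S X) =
    p * (r ^+ 2 * (a - sin a * cos a)) + u * (2 / 3 * (r * sin a) ^+ 3).
  move=> mf fE.
  have E : (fun X => f X * \1_S X) \o frame O c s =
      (fun X => p * \1_S0 X + u * (X.1 * \1_S0 X) + v * (X.2 * \1_S0 X)).
    by apply/funext => X /=; rewrite IST fE; ring.
  have J0 : area_measure.-integrable [set: plane]
      (EFin \o (fun X : plane => p * \1_S0 X)).
    exact: (integrableZl measurableT p I0).
  have J1 : area_measure.-integrable [set: plane]
      (EFin \o (fun X : plane => u * (X.1 * \1_S0 X))).
    exact: (integrableZl measurableT u I1).
  have J2 : area_measure.-integrable [set: plane]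
      (EFin \o (fun X : plane => v * (X.2 * \1_S0 X))).
    exact: (integrableZl measurableT v I2).
  have J01 : area_measure.-integrable [set: plane]
      (EFin \o (fun X : plane => p * \1_S0 X + u * (X.1 * \1_S0 X))).
    exact: (integrableD measurableT J0 J1).
  transitivity (\int[area_measure]_X ((fun X => f X * \1_S X) \o frame O c s) X).
    apply: (Rintegral_area_preserving pT (measurable_funM mf mI)).
    by rewrite E; exact: (integrableD measurableT J01 J2).
  rewrite E.
  rewrite RintegralD// RintegralD// !RintegralZl//.
  by rewrite area_standard_segment// moment_standard_segment//
    Rintegral_standard_segment_ordinate// mulr0 addr0.
have mass_S : mass \1_S = r ^+ 2 * (a - sin a * cos a).
  rewrite /mass; under eq_Rintegral do rewrite -[\1__ _]mul1r.
  rewrite (affine (cst 1) 1 0 0); first by ring.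
    exact: measurable_cst.
  by move=> X /=; ring.
have a_neq0 : r ^+ 2 * (a - sin a * cos a) != 0.
  by rewrite gt_eqF// area_standard_segment_gt0.
rewrite /centroid /barycenter mass_S.
rewrite (affine fst O.1 c (- s))//; last by move=> X /=; ring.
rewrite (affine snd O.2 s c)//; last by move=> X /=; ring.
rewrite [RHS]surjective_pairing; congr pair; rewrite mulrDl mulfK//=;
  by congr (_ + _); rewrite [RHS]mulrC [RHS]mulrA.
Qed.

(** In the frame at [O] with axis OB, D has abscissa r cos a and B - D is r (1 - cos a) times the
    unit axis vector. That factor is positive, so the sign condition on the dot product compares the
    abscissa of X with r cos a. *)
Lemma circular_segment_unframe (O : R * R) (r a phi : R) : 0 < r -> 0 < a < pi ->
  circular_segment O r (circle_point O r (phi - a)) (circle_point O r phi)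
    (circle_point O r (phi + a)) =
  unframe O (cos phi) (sin phi) @^-1` standard_segment r (r * cos a).
Proof.
move=> r0 /andP[a0 api]; have r0' := ltW r0.
have cos_lt1 : 0 < r * (1 - cos a).
  rewrite mulr_gt0// subr_gt0 -[ltRHS](@cos0 R) ltr_cos// in_itv/=.
    by rewrite lexx pi_ge0.
  by rewrite !ltW.
have cs1 : cos phi ^+ 2 + sin phi ^+ 2 = 1 := cos2Dsin2 phi.
apply/seteqP; rewrite /circular_segment.
have DE : midpoint (circle_point O r (phi - a)) (circle_point O r (phi + a)) =
    O + (r * cos a) *: (cos phi, sin phi).
  case: O => o1 o2; rewrite /midpoint /circle_point [LHS]surjective_pairing/=.
  rewrite cosB cosD sinB sinD /GRing.scale/= [RHS]surjective_pairing/=.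
  by congr pair; rewrite /GRing.scale/=; field.
have H X : (dist O X <= r /\ 0 <= dot (circle_point O r phi -
      midpoint (circle_point O r (phi - a)) (circle_point O r (phi + a)))
    (X - midpoint (circle_point O r (phi - a)) (circle_point O r (phi + a)))) <->
    standard_segment r (r * cos a) (unframe O (cos phi) (sin phi) X).
  rewrite DE /standard_segment /unframe/=.
  set p := cos phi * _ + _; set q := cos phi * _ - _.
  (* Here [p] and [q] are the coordinates of X in the frame; the rotation preserves the Euclidean
     norm. *)
  have -> : dist O X = Num.sqrt (p ^+ 2 + q ^+ 2).
    congr Num.sqrt; rewrite /dot/= -[LHS]mul1r -cs1 /p /q; ring.
  have -> : dot (circle_point O r phi - (O + (r * cos a) *: (cos phi, sin phi)))
      (X - (O + (r * cos a) *: (cos phi, sin phi))) =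
      r * (1 - cos a) * (p - r * cos a).
    rewrite /dot /circle_point/= /GRing.scale/= /GRing.scale/= /p.
    transitivity (r * (1 - cos a) * (cos phi * (X.1 - O.1) + sin phi * (X.2 - O.2) -
      r * cos a * (cos phi ^+ 2 + sin phi ^+ 2))); first by ring.
    by rewrite cs1 mulr1.
  rewrite pmulr_rge0// subr_ge0 -{1}(ger0_norm r0') -(sqrtr_sqr r).
  by rewrite ler_sqrt// sqr_ge0.
by split => X /H.
Qed.

End CircularSegment.

Theorem theorem3p12 (R : realType) (r theta : R) (O A B C K H : R * R)
    (r_gt0 : 0 < r) (theta_gt0 : 0 < theta) (theta_lt2pi : theta < 2 * pi)
    (arcABC : arc_points O r theta A B C)
    (triangleKOH : huygens_triangle O A B C K H)
    (huygens : combined_barycenter (circular_segment O r A B C)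
                 (triangle K O H) = O) :
  dist O (centroid (circular_segment O r A B C)) =
    4 / 3 * (r * sin (theta / 2) ^+ 3 / (theta - sin theta)).
Proof.
case: arcABC => phi [-> -> ->].
have api : 0 < theta / 2 < pi by apply/andP; split; lra.
(* With a = theta / 2, this turns theta - sin theta into 2 (a - sin a cos a), the factor in the
   area. *)
have sin_theta : sin theta = 2 * (sin (theta / 2) * cos (theta / 2)).
  by rewrite {1}(splitr theta) sinD; ring.
have area_gt0 := area_standard_segment_gt0 r_gt0 api.
rewrite circular_segment_unframe// centroid_frame_standard_segment//; last first.
  exact: cos2Dsin2.
set m := _ / _ : R.
(* The centroid is O + m (cos phi, sin phi), at distance |m| from [O]; the sign of [m] removes the
   absolute value. *)
have m_ge0 : 0 <= m.
  rewrite divr_ge0 ?(ltW area_gt0)// mulr_ge0 ?exprn_ge0 ?mulr_ge0 ?(ltW r_gt0)//.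
  by rewrite ltW// sin_gt0_pi.
transitivity m.
  rewrite -[RHS]ger0_norm// -sqrtr_sqr /dist; congr Num.sqrt.
  rewrite /dot/= /GRing.scale/=.
  transitivity (m ^+ 2 * (cos phi ^+ 2 + sin phi ^+ 2)); first by ring.
  by rewrite cos2Dsin2 mulr1.
(* Positivity of the area shows that the denominator theta - sin theta is nonzero. *)
have := gt_eqF area_gt0.
rewrite mulf_eq0 expf_eq0/= gt_eqF//= => /negbT d0.
have r_neq0 : r != 0 by rewrite gt_eqF.
rewrite /m sin_theta; field; rewrite r_neq0 andbT.
rewrite [X in X != 0](_ : _ = 2 * (theta / 2 - sin (theta / 2) * cos (theta / 2))).
  by rewrite mulf_neq0.
by field.
Qed.
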